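(* Suppose the following hold: (1) $X_\nu$ is nonempty and compact. (2) For each $x \in X_\nu$, $\mathbb{P}\{\max_{j} g_j(x,\xi) = 0\} = 0$. (3) For each $k \in \mathbb{N}$ and $j \in \{1,\dots,m\}$: (A) $\phi_{k,j}:\mathbb{R}\to\mathbb{R}$ is continuously differentiable; (B) $\phi_{k,j}$ is nondecreasing; (C) there is a constant $M_\phi > 0$, independent of $j$ and $k$, with $|\phi_{k,j}(y)| \le M_\phi$ for all $y \in \mathbb{R}$; (D) $\lim_{k\to\infty} \phi_{k,j}(y) = \mathbf{1}[y]$ for all $y \in \mathbb{R}\setminus\{0\}$. Then $$\lim_{k\to\infty}\ \min_{x\in X_\nu} \hat p_k(x) = \min_{x\in X_\nu} p(x) \quad\text{and}\quad \limsup_{k\to\infty}\ \operatorname*{arg\,min}_{x\in X_\nu} \hat p_k(x) \subset \operatorname*{arg\,min}_{x \in X_\nu} p(x),$$ where the $\limsup$ is the outer limit of a sequence of sets.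
   Context: $X \subset \mathbb{R}^n$ is a nonempty closed convex set, $\xi$ is a random vector with probability distribution $\mathcal{P}$ supported on $\Xi \subset \mathbb{R}^d$, $f:\mathbb{R}^n\to\mathbb{R}$ is continuous and quasiconvex, and $g=(g_1,\dots,g_m):\mathbb{R}^n\times\mathbb{R}^d\to\mathbb{R}^m$ is continuously differentiable. Fix $\nu\in\mathbb{R}$ and let $X_\nu := \{x\in X : f(x)\le \nu\}$. The step function is $\mathbf{1}[z]=1$ if $z>0$ and $\mathbf{1}[z]=0$ if $z\le 0$. Define $p(x) := \mathbb{P}\{g(x,\xi)\not\le 0\}$, where $g(x,\xi)\not\le 0$ means that at least one component $g_j(x,\xi)$ is positive; equivalently $p(x)=\mathbb{E}[\max_j \mathbf{1}[g_j(x,\xi)]]$. For each $k\in\mathbb{N}$ there are functions $\phi_{k,j}:\mathbb{R}\to\mathbb{R}$, $j=1,\dots,m$ (smooth approximations of the step function), and $\hat p_k(x) := \mathbb{E}[\max_{j\in\{1,\dots,m\}} \phi_{k,j}(g_j(x,\xi))]$. Measurability of random functions is assumed throughout. The outer limit $\limsup_k C_k$ of sets $C_k\subset\mathbb{R}^n$ is the set of all accumulation points of sequences $\{x_k\}$ with $x_k\in C_k$; that is, all $x$ for which there are indices $k_1<k_2<\cdots$ and $x_{k_i}\in C_{k_i}$ with $x_{k_i}\to x$. *)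

(* Defs.v *)
From HB Require Import structures.
From mathcomp Require Import all_boot all_order all_algebra.
From mathcomp Require Import all_classical all_reals all_analysis.

Set Implicit Arguments.
Unset Strict Implicit.
Unset Printing Implicit Defensive.

Import Order.TTheory GRing.Theory Num.Theory.
Import numFieldNormedType.Exports.

Local Open Scope classical_set_scope.
Local Open Scope ring_scope.
Local Open Scope convex_scope.

Definition quasiconvex (R : realType) (n : nat) (f : 'rV[R]_n -> R) : Prop :=
  forall (t : {i01 R}) (x y : convex_lmodType 'rV[R]_n),
    f (x <| t |> y) <= Num.max (f x) (f y).

(* C^1 in the Frechet sense: the differential depends continuously on the
   point for the operator norm. *)
Definition continuously_differentiable (R : realType)
    (V W : normedModType R) (F : V -> W) : Prop :=
  (forall z, differentiable F z) /\
  (forall z (e : R), 0 < e ->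
     \forall z' \near z, forall v, `|'d F z' v - 'd F z v| <= e * `|v|).

Definition step (R : realType) (z : R) : R := if 0 < z then 1 else 0.

(* The maximum is over a nonempty family, so the initial value [v ord0] of the
   iterated maximum contributes nothing extra. *)
Definition vmax (R : realType) (m : nat) (v : 'I_m.+1 -> R) : R :=
  \big[Num.max/v ord0]_(j < m.+1) v j.

(* R^d with its Borel sigma-algebra; the underlying type is ['rV[R]_d]. *)
Definition borel_rV (R : realType) (d : nat) :=
  g_sigma_algebraType (@open 'rV[R]_d).

Definition sublevel (R : realType) (n : nat) (X : set 'rV[R]_n)
    (f : 'rV[R]_n -> R) (nu : R) : set 'rV[R]_n :=
  [set x | X x /\ f x <= nu].

Section prob_functions.
Context (R : realType) (n d m : nat) (disp : measure_display)
  (T : measurableType disp) (P : probability T R)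
  (xi : {RV P >-> borel_rV R d})
  (g : 'rV[R]_n * 'rV[R]_d -> 'rV[R]_m.+1).

Definition violation_prob (x : 'rV[R]_n) : \bar R :=
  P [set w | exists j, 0 < g (x, xi w) ord0 j].

Definition approx_prob (phi : 'I_m.+1 -> R -> R) (x : 'rV[R]_n) : \bar R :=
  ('E_P[fun w => vmax (fun j => phi j (g (x, xi w) ord0 j))])%E.

End prob_functions.

Definition argmin (R : realType) (E : Type) (A : set E) (F : E -> \bar R) :
    set E :=
  [set x | A x /\ forall y, A y -> (F x <= F y)%E].

(* [v] is the minimum of [F] over [A]; in particular it is attained. *)
Definition is_min (R : realType) (E : Type) (A : set E) (F : E -> \bar R)
    (v : \bar R) : Prop :=
  exists2 x, argmin A F x & F x = v.

Definition outer_limit (E : topologicalType) (C : nat -> set E) : set E :=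
  [set x | exists (k : nat -> nat) (u : nat -> E),
     [/\ {homo k : i j / (i < j)%N >-> (i < j)%N},
         forall i, C (k i) (u i)
       & u i @[i --> \oo] --> x]].

(* Main.v *)
(* The approximations converge continuously: if [x_k -> x] in [X_nu], then for
   almost every [w] no ambiguity [max_j g_j (x, xi w) = 0] occurs, so the
   integrands defining [p_k(x_k)] converge pointwise to the one defining [p(x)],
   and bounded convergence gives [p_k(x_k) -> p(x)].  Passing to the limit in
   [p_k(x_k) <= p_k(y)] along a subsequence of minimizers shows that every
   accumulation point minimizes [p]; compactness provides such points, and in
   particular a minimizer of [p].  Since every subsequence of minimal
   values has a further subsequence tending to [min p], the whole sequence
   does. *)
Require Import Defs.
From HB Require Import structures.
From mathcomp Require Import all_boot all_order all_algebra.
From mathcomp Require Import all_classical all_reals all_analysis.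
From mathcomp Require Import measurable_realfun lra.

Set Implicit Arguments.
Unset Strict Implicit.
Unset Printing Implicit Defensive.

Import Order.TTheory GRing.Theory Num.Theory.
Import numFieldNormedType.Exports.

Local Open Scope classical_set_scope.
Local Open Scope ring_scope.

(** * Extraction of convergent subsequences *)

Section extracted_subsequences.

Lemma strictly_increasing_geq (k : nat -> nat) :
  {homo k : i j / (i < j)%N} -> forall i, (i <= k i)%N.
Proof. by move=> kinc; elim=> // i /leq_ltn_trans; apply; exact: kinc. Qed.

Lemma cvgny_strictly_increasing (k : nat -> nat) :
  {homo k : i j / (i < j)%N} -> k i @[i --> \oo] --> \oo.
Proof.
move=> /strictly_increasing_geq kge U [N _ NU].
by exists N => // i /= Ni; apply: NU => /=; exact: leq_trans (kge i).
Qed.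

(** Compactness gives a cluster point [x]; the [i]-th index is then picked beyond the previous one,
    with its term within [1/(i+1)] of [x]. *)
Lemma compact_cvg_subsequence (R : realType) (V : pseudoMetricType R)
    (A : set V) (u : nat -> V) : compact A -> (forall i, A (u i)) ->
  exists k x, [/\ {homo k : i j / (i < j)%N}, A x
    & u (k i) @[i --> \oo] --> x].
Proof.
move=> cA Au.
have uA : (u @ \oo) A by exists 0%N => // i _; exact: Au.
have [x [Ax clx]] := cA (u @ \oo) _ uA.
have next N i : {k | (N < k)%N /\ ball x i.+1%:R^-1 (u k)}.
  apply: cid.
  (* Tails of [u] belong to the filter clustering at [x], so every ball around [x] meets them. *)
  have uN : (u @ \oo) [set u k | k in [set k | (N < k)%N]].
    by exists N.+1 => // k /= Nk; exists k.
  have xi : nbhs x (ball x (i.+1%:R^-1 : R)) by apply: nbhsx_ballx.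
  by have [_ [[k Nk <-] xk]] := clx _ _ uN xi; exists k.
pose k := fix k i := sval (next (if i is j.+1 then k j else 0%N) i).
have kball i : ball x i.+1%:R^-1 (u (k i)).
  by case: i => [|i] /=; case: (next _ _) => m [].
exists k, x; split => //.
  by apply: (homo_ltn ltn_trans) => i /=; case: (next _ _) => m [].
apply/cvg_ballP => e e0; near=> i.
apply: le_ball (kball i); apply: ltW.
by near: i; exact: (near_infty_natSinv_lt (PosNum e0)).
Unshelve. all: by end_near. Qed.

(** Otherwise some neighbourhood of [l] is missed at arbitrarily large indices, and these form a
    subsequence with no further subsequence tending to [l]. *)
Lemma cvg_sub_subsequence (V : topologicalType) (v : nat -> V) (l : V) :
  (forall k, {homo k : i j / (i < j)%N} ->
    exists2 h, {homo h : i j / (i < j)%N} &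
      v (k (h i)) @[i --> \oo] --> l) ->
  v k @[k --> \oo] --> l.
Proof.
move=> vsub U Ul; apply: contrapT => nU.
have bad N : {k | (N < k)%N /\ ~ U (v k)}.
  apply: cid; apply: contrapT => noN; apply: nU.
  exists N.+1 => // k /= Nk; apply: contrapT => nUk.
  by apply: noN; exists k.
have [k [_ kP]] := dependent_choice bad 0%N.
(* The shift by [S] drops the starting index [0], at which [v] may well lie in [U]. *)
have kinc : {homo (k \o S) : i j / (i < j)%N}.
  by apply: (homo_ltn ltn_trans) => i /=; case: (kP i.+1).
have [h _ /(_ U Ul)[N _ NU]] := vsub _ kinc.
by have [_] := kP (h N); apply; exact: (NU N (leqnn N)).
Qed.

End extracted_subsequences.

(** * Minimizers under continuous convergence *)

Section minimizers.
Context (R : realType) (V : pseudoMetricType R) (A : set V).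
Hypothesis cA : compact A.
Local Open Scope ereal_scope.

(** Direct method: a minimizing sequence has a subsequence converging in [A], along which the values
    tend both to [F x] and to the infimum. *)
Lemma argmin_nonempty (F : V -> \bar R) : A !=set0 ->
  (forall u x, (forall i, A (u i)) -> A x -> u i @[i --> \oo] --> x ->
    F (u i) @[i --> \oo] --> F x) ->
  argmin A F !=set0.
Proof.
move=> [a Aa] Fcont.
have FA0 : F @` A != set0 by apply/set0P; exists (F a); exists a.
have [y FAy ycvg] := ereal_inf_seq FA0.
have /choice[u uP] : forall i, exists x, A x /\ F x = y i.
  by move=> i; have [x Ax Fx] := FAy i; exists x.
have [k [x [kinc Ax ux]]] := compact_cvg_subsequence cA (fun i => (uP i).1).
exists x; split => // z Az.
suff -> : F x = ereal_inf (F @` A) by apply: ereal_inf_lbound; exists z.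
have Fx : F (u (k i)) @[i --> \oo] --> F x.
  exact: (Fcont (u \o k) x (fun i => (uP (k i)).1)).
have Fy : F (u (k i)) @[i --> \oo] --> ereal_inf (F @` A).
  under eq_fun do rewrite (uP _).2.
  exact: (cvg_comp _ _ (cvgny_strictly_increasing kinc) ycvg).
exact: (cvg_unique (@ereal_hausdorff R) Fx Fy).
Qed.

Hypothesis hV : hausdorff_space V.
Variables (F : nat -> V -> \bar R) (G : V -> \bar R).
Hypothesis FG_cvg : forall k u x, {homo k : i j / (i < j)%N} ->
  (forall i, A (u i)) -> A x -> u i @[i --> \oo] --> x ->
  F (k i) (u i) @[i --> \oo] --> G x.

(** Each competitor [y] is treated as a constant sequence, so [FG_cvg] gives the limits of both
    sides of [F (k i) (u i) <= F (k i) y]. *)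
Lemma outer_limit_argmin :
  outer_limit (fun k => argmin A (F k)) `<=` argmin A G.
Proof.
move=> x [k [u [kinc uk ux]]].
have Au i : A (u i) := (uk i).1.
have Ax : A x.
  by apply: (closed_cvg A (compact_closed hV cA) _ x ux); exact: nearW.
split => // y Ay.
have Fx : F (k i) (u i) @[i --> \oo] --> G x by exact: FG_cvg.
have Fy : F (k i) y @[i --> \oo] --> G y.
  by apply: (FG_cvg (u := fun=> y)) => //; exact: cvg_cst.
rewrite -(cvg_lim (@ereal_hausdorff R) Fx) -(cvg_lim (@ereal_hausdorff R) Fy).
apply: lee_lim; [by apply/cvg_ex; eexists; exact: Fx|
  by apply/cvg_ex; eexists; exact: Fy|].
by apply: nearW => i; exact: (uk i).2.
Qed.

(** Different subsequences may lead to different minimizers of [G], but [G] takes the same value at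
    all of them, so the minimal values have a single possible limit. *)
Lemma cvg_argmin (u : nat -> V) : (forall k, argmin A (F k) (u k)) ->
  exists2 x, argmin A G x & F k (u k) @[k --> \oo] --> G x.
Proof.
move=> uP.
have Au i : A (u i) := (uP i).1.
have sub k : {homo k : i j / (i < j)%N} -> exists h x,
    [/\ {homo h : i j / (i < j)%N}, argmin A G x
      & F (k (h i)) (u (k (h i))) @[i --> \oo] --> G x].
  move=> kinc.
  have [h [x [hinc Ax ux]]] := compact_cvg_subsequence cA (fun i => Au (k i)).
  have khinc : {homo k \o h : i j / (i < j)%N}.
    by move=> i j ij; apply/kinc/hinc.
  exists h, x; split => //; last exact: (FG_cvg khinc).
  by apply: outer_limit_argmin; exists (k \o h), (u \o (k \o h)); split.
(* The full sequence, extracted by [id], supplies a reference minimizer [x0]. *)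
have [//|_ [x0 [_ x0min _]]] := sub id; exists x0 => //.
apply: cvg_sub_subsequence => k /sub[h [x [hinc xmin Fx]]]; exists h => //.
suff -> : G x0 = G x by [].
by apply/eqP; rewrite eq_le x0min.2 ?xmin.2//; [exact: x0min.1|exact: xmin.1].
Qed.

End minimizers.

(** * Finite maxima: order, limits and measurability *)

Section vmax_lemmas.
Context (R : realType) (m : nat).
Implicit Types v : 'I_m.+1 -> R.

Lemma le_vmax v j : v j <= vmax v.
Proof. exact: le_bigmax. Qed.

Lemma vmax_eq v : exists j, vmax v = v j.
Proof.
apply: (@big_ind _ (fun x => exists j, x = v j)) => [|x y [i ->] [j ->]|i _].
- by exists ord0.
- by case: (leP (v i) (v j)) => _; [exists j|exists i].
- by exists i.
Qed.

Lemma vmax_ltP v a : reflect (forall j, v j < a) (vmax v < a).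
Proof.
apply: (iffP idP) => [va j|va]; first exact: le_lt_trans (le_vmax v j) va.
by have [j ->] := vmax_eq v.
Qed.

Lemma vmax_gtP v a : reflect (exists j, a < v j) (a < vmax v).
Proof.
apply: (iffP idP) => [|[j aj]]; last exact: lt_le_trans aj (le_vmax v j).
by have [j ->] := vmax_eq v; exists j.
Qed.

Lemma normr_vmax_le v M : (forall j, `|v j| <= M) -> `|vmax v| <= M.
Proof. by move=> vM; have [j ->] := vmax_eq v. Qed.

Lemma cvg_vmax (v : nat -> 'I_m.+1 -> R) (a : 'I_m.+1 -> R) :
  (forall j, v i j @[i --> \oo] --> a j) ->
  vmax (v i) @[i --> \oo] --> vmax a.
Proof.
move=> va; apply/cvgrPdist_lt => e e0.
have near_a : \forall i \near \oo, forall j, `|a j - v i j| < e.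
  by apply: filter_forall => j; move/cvgrPdist_lt : (va j); exact.
(* The lower bound follows the one component where [vmax a] is attained; the upper bound uses all
   components. *)
apply: filterS near_a => i ai; rewrite ltr_distlC; apply/andP; split.
  have [j ->] := vmax_eq a.
  by apply/vmax_gtP; exists j; move: (ai j); rewrite ltr_distlC => /andP[].
apply/vmax_ltP => j; move: (ai j); rewrite ltr_distlC => /andP[_ /lt_le_trans].
by apply; rewrite lerD2r le_vmax.
Qed.

Lemma measurable_vmax d (T : measurableType d) (h : 'I_m.+1 -> T -> R) :
  (forall j, measurable_fun setT (h j)) ->
  measurable_fun setT (fun w => vmax (fun j => h j w)).
Proof.
move=> mh; rewrite /vmax.
elim: (index_enum _) => [|i s IHs].
  by under eq_fun do rewrite big_nil; exact: mh.
by under eq_fun do rewrite big_cons; exact: measurable_maxr.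
Qed.

End vmax_lemmas.

(* The limit is not required at [0], where the step function jumps;
   monotonicity lets the moving argument be compared with fixed nonzero ones. *)
Section step_approximation.
Context (R : realType) (phi : nat -> R -> R).
Hypothesis phi_ndecr : forall k, {homo phi k : y z / y <= z}.
Hypothesis phi_cvg : forall y, y != 0 -> phi k y @[k --> \oo] --> step y.
Variables (z : nat -> R) (a : R).
Hypothesis z_cvg : z i @[i --> \oo] --> a.

Lemma phi_lt_near y e : a < y -> y != 0 -> 0 < e ->
  \forall k \near \oo, phi k (z k) < step y + e.
Proof.
move=> ay y0 e0.
have zy : \forall k \near \oo, z k < y by exact: cvgr_lt z_cvg _ ay.
have phie := (cvgr_lt _ (phi_cvg y0)) (step y + e) _.
near=> k; apply: le_lt_trans (phi_ndecr _ _) _.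
  by apply: ltW; near: k; exact: zy.
by near: k; apply: phie; rewrite ltrDl.
Unshelve. all: by end_near. Qed.

Lemma phi_gt_near y e : y < a -> y != 0 -> 0 < e ->
  \forall k \near \oo, step y - e < phi k (z k).
Proof.
move=> ay y0 e0.
have zy : \forall k \near \oo, y < z k by exact: cvgr_gt z_cvg _ ay.
have phie := (cvgr_gt _ (phi_cvg y0)) (step y - e) _.
near=> k; apply: lt_le_trans (phi_ndecr _ _); last first.
  by apply: ltW; near: k; exact: zy.
by near: k; apply: phie; rewrite ltrBlDr ltrDl.
Unshelve. all: by end_near. Qed.

End step_approximation.

(** Some [a j] may vanish even though [vmax a] does not, and [phi k j (z k j)] need not converge for
    such [j]. It suffices to bound all components from above by one test point [y] beyond [vmax a],
    and a maximizing component from below by a test point [y'], both having the sign of [vmax a]. *)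
Lemma cvg_vmax_step (R : realType) (m : nat) (phi : nat -> 'I_m.+1 -> R -> R)
    (z : nat -> 'I_m.+1 -> R) (a : 'I_m.+1 -> R) :
  (forall k j, {homo phi k j : y z / y <= z}) ->
  (forall j y, y != 0 -> phi k j y @[k --> \oo] --> step y) ->
  (forall j, z k j @[k --> \oo] --> a j) -> vmax a != 0 ->
  vmax (fun j => phi k j (z k j)) @[k --> \oo] --> step (vmax a).
Proof.
move=> ndecr phi_cvg za a0; apply/cvgrPdist_lt => e e0.
have [y [ay y0 sy]] :
    exists y, [/\ vmax a < y, y != 0 & step y = step (vmax a)].
  (* Going up, halving keeps a negative number negative and adding one keeps a positive number
     positive; for [y'] the two choices are swapped. *)
  have [an|ap|/eqP] := ltgtP (vmax a) 0; last by rewrite (negPf a0).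
    have an2 : vmax a / 2 < 0 by lra.
    exists (vmax a / 2); split; [lra|by rewrite lt_eqF|].
    by rewrite /step ltNge ltW//= ltNge ltW.
  exists (vmax a + 1); split; [lra|by rewrite gt_eqF ?addr_gt0|].
  by rewrite /step ap addr_gt0.
have [j [y' [ay' y'0 sy']]] :
    exists j y', [/\ y' < a j, y' != 0 & step y' = step (vmax a)].
  have [j aj] := vmax_eq a; exists j; rewrite -aj.
  have [an|ap|/eqP] := ltgtP (vmax a) 0; last by rewrite (negPf a0).
    have an1 : vmax a - 1 < 0 by lra.
    exists (vmax a - 1); split; [lra|by rewrite lt_eqF|].
    by rewrite /step ltNge ltW//= ltNge ltW.
  exists (vmax a / 2); split; [lra|by rewrite gt_eqF ?divr_gt0|].
  by rewrite /step ap divr_gt0.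
have upper : \forall k \near \oo, forall j, phi k j (z k j) < step y + e.
  apply: filter_forall => i.
  apply: (phi_lt_near (ndecr ^~ i) (phi_cvg i) (za i) _ y0 e0).
  exact: le_lt_trans (le_vmax a i) ay.
have lower := phi_gt_near (ndecr ^~ j) (phi_cvg j) (za j) ay' y'0 e0.
rewrite sy in upper; rewrite sy' in lower.
near=> k; rewrite ltr_distlC; apply/andP; split.
  by apply/vmax_gtP; exists j; near: k.
by apply/vmax_ltP => i; move: i; near: k.
Unshelve. all: by end_near. Qed.

(** * Continuity of sections and bounded convergence of expectations *)

Lemma continuous_section (U V W : topologicalType) (h : U * V -> W) (x : U) :
  continuous h -> continuous (fun y => h (x, y)).
Proof.
move=> hcont y; apply: (@cvg_comp _ _ _ (fun z => (x, z)) h _ (nbhs (x, y))).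
  by apply: cvg_pair => //; exact: cvg_cst.
exact: hcont.
Qed.

(** Dominated convergence with the constant [M], integrable because [P] is finite. *)
Lemma bounded_convergence d (T : measurableType d) (R : realType)
    (P : probability T R) (h : nat -> T -> R) (h0 : T -> R) (M : R) :
  (forall k, measurable_fun setT (h k)) -> measurable_fun setT h0 ->
  (forall k w, `|h k w| <= M) ->
  {ae P, forall w, h k w @[k --> \oo] --> h0 w} ->
  ('E_P[h k] @[k --> \oo] --> 'E_P[h0])%E.
Proof.
move=> mh mh0 hM hcvg.
have [|||||_ _] := @dominated_convergence _ _ _ P setT measurableT
  (fun k => EFin \o h k) (EFin \o h0) (EFin \o cst M).
- by move=> k; exact/measurable_EFinP.
- exact/measurable_EFinP.
- by apply: filterS hcvg => w hw _; apply: cvg_EFin hw; exact: nearW.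
- exact: finite_measure_integrable_cst.
- by apply: nearW => w k _; rewrite lee_fin.
by rewrite unlock.
Qed.

Lemma fin_num_expectation d (T : measurableType d) (R : realType)
    (P : probability T R) (h : T -> R) (M : R) :
  measurable_fun setT h -> (forall w, `|h w| <= M) ->
  ('E_P[h] \is a fin_num)%E.
Proof.
move=> mh hM; apply: expectation_fin_num; apply/Lfun1_integrable.
apply: (le_integrable measurableT _ _
  (finite_measure_integrable_cst P M measurableT)).
  exact/measurable_EFinP.
by move=> w _ /=; rewrite lee_fin (le_trans (hM w))// ler_norm.
Qed.

(** * Measurability and convergence of the probability functions *)

Section probabilistic_functions.
Context (R : realType) (n d m : nat) (disp : measure_display)
  (T : measurableType disp) (P : probability T R)
  (xi : {RV P >-> borel_rV R d})
  (g : 'rV[R]_n * 'rV[R]_d -> 'rV[R]_m.+1).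
Hypothesis g_cont : continuous g.

Lemma measurable_borel_rV (h : 'rV[R]_d -> R) :
  continuous h -> measurable_fun setT (h : borel_rV R d -> R).
Proof.
(* Open intervals generate the Borel sets of the line, and their preimages are open. *)
move=> /continuousP ch; apply: (measurability _ (RGenOpens.measurableE R)).
move=> _ [_ [a [b ->] <-]]; rewrite setTI; apply: sub_sigma_algebra.
exact/ch/interval_open.
Qed.

Lemma continuous_constraint j : continuous (fun p => g p ord0 j).
Proof.
move=> p; apply: (@continuous_comp _ _ _ g (fun M => M ord0 j)).
  exact: g_cont.
exact: coord_continuous.
Qed.

Lemma cvg_constraint (u : nat -> 'rV[R]_n) x y j :
  u i @[i --> \oo] --> x ->
  g (u i, y) ord0 j @[i --> \oo] --> g (x, y) ord0 j.
Proof.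
move=> ux; have uxy : (u i, y) @[i --> \oo] --> (x, y).
  by apply: (cvg_pair (G := nbhs x) (H := nbhs y)) => //; exact: cvg_cst.
exact: cvg_comp uxy (@continuous_constraint j (x, y)).
Qed.

Lemma measurable_constraint x j :
  measurable_fun setT (fun w => g (x, xi w) ord0 j).
Proof.
have cont := continuous_section (x := x) (@continuous_constraint j).
exact: measurableT_comp (measurable_borel_rV cont) _.
Qed.

Lemma measurable_violation x :
  measurable [set w | exists j, 0 < g (x, xi w) ord0 j].
Proof.
rewrite (_ : [set _ | _] =
    (fun w => vmax (fun j => g (x, xi w) ord0 j)) @^-1` `]0, +oo[).
  rewrite -[X in measurable X]setTI; apply: measurable_vmax => //.
  by move=> j; exact: measurable_constraint.
apply/seteqP; split => w /=; rewrite in_itv/= andbT.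
  by move=> ?; exact/vmax_gtP.
by move=> /vmax_gtP.
Qed.

Let indicator_violation x : \1_[set w | exists j, 0 < g (x, xi w) ord0 j] =
  (fun w => step (vmax (fun j => g (x, xi w) ord0 j))).
Proof.
apply/funext => w; rewrite indicE /step.
by case: vmax_gtP => h; [rewrite mem_set|rewrite memNset].
Qed.

(** Puts the limit in the form of an expectation, as bounded convergence requires. *)
Lemma violation_probE x : violation_prob xi g x =
  ('E_P[fun w => step (vmax (fun j => g (x, xi w) ord0 j))])%E.
Proof.
rewrite -indicator_violation expectation_indic//; exact: measurable_violation.
Qed.

Lemma measurable_step_vmax x :
  measurable_fun setT (fun w => step (vmax (fun j => g (x, xi w) ord0 j))).
Proof.
rewrite -indicator_violation; apply: measurable_indic.
exact: measurable_violation.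
Qed.

Lemma measurable_approx (psi : 'I_m.+1 -> R -> R) x :
  (forall j, continuous (psi j)) ->
  measurable_fun setT (fun w => vmax (fun j => psi j (g (x, xi w) ord0 j))).
Proof.
move=> cpsi; apply: measurable_vmax => j.
apply: measurableT_comp; last exact: measurable_constraint.
exact: continuous_measurable_fun.
Qed.

Lemma approx_prob_fin_num (psi : 'I_m.+1 -> R -> R) (M : R) x :
  (forall j, continuous (psi j)) -> (forall j y, `|psi j y| <= M) ->
  approx_prob xi g psi x \is a fin_num.
Proof.
move=> cpsi psiM; apply: (@fin_num_expectation _ _ _ P _ M).
  exact: measurable_approx.
by move=> w; exact: normr_vmax_le.
Qed.

(** Sequential continuity for a fixed [psi], which yields the minimizers of each approximation
    through [argmin_nonempty]. *)
Lemma cvg_approx_prob (psi : 'I_m.+1 -> R -> R) (M : R) u x :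
  (forall j, continuous (psi j)) -> (forall j y, `|psi j y| <= M) ->
  u i @[i --> \oo] --> x ->
  approx_prob xi g psi (u i) @[i --> \oo] --> approx_prob xi g psi x.
Proof.
move=> cpsi psiM ux; apply: (bounded_convergence (M := M)).
- by move=> k; exact: measurable_approx.
- exact: measurable_approx.
- by move=> k w; exact: normr_vmax_le.
apply: nearW => w; apply: cvg_vmax => j.
by apply: continuous_cvg; [exact: cpsi|exact: cvg_constraint].
Qed.

Lemma cvg_approx_prob_violation (phi : nat -> 'I_m.+1 -> R -> R) (M : R) u x :
  (forall k j, continuous (phi k j)) ->
  (forall k j, {homo phi k j : y z / y <= z}) ->
  (forall k j y, `|phi k j y| <= M) ->
  (forall j y, y != 0 -> phi k j y @[k --> \oo] --> step y) ->
  P [set w | vmax (fun j => g (x, xi w) ord0 j) = 0] = 0%E ->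
  u i @[i --> \oo] --> x ->
  approx_prob xi g (phi i) (u i) @[i --> \oo] --> violation_prob xi g x.
Proof.
move=> cphi ndecr phiM phi_cvg Px0 ux; rewrite violation_probE.
apply: (bounded_convergence (M := M)).
- by move=> k; exact: measurable_approx.
- exact: measurable_step_vmax.
- by move=> k w; exact: normr_vmax_le.
(* The exceptional null set is that of zero maximum; off it [cvg_vmax_step] applies. *)
exists [set w | vmax (fun j => g (x, xi w) ord0 j) = 0]; split => //.
  rewrite (_ : [set _ | _] =
      (fun w => vmax (fun j => g (x, xi w) ord0 j)) @^-1` [set 0])//.
  rewrite -[X in measurable X]setTI; apply: measurable_vmax => //.
  by move=> j; exact: measurable_constraint.
move=> w /= ncvg; apply: contrapT => /eqP nz; apply: ncvg.
by apply: cvg_vmax_step => // j; exact: cvg_constraint.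
Qed.

End probabilistic_functions.

Theorem theorem1 (R : realType) (n d m : nat)
  (X : set 'rV[R]_n) (Xi : set 'rV[R]_d)
  (disp : measure_display) (T : measurableType disp) (P : probability T R)
  (xi : {RV P >-> borel_rV R d})
  (f : 'rV[R]_n -> R) (g : 'rV[R]_n * 'rV[R]_d -> 'rV[R]_m.+1)
  (nu : R) (phi : nat -> 'I_m.+1 -> R -> R)
  (X_nonempty : X !=set0) (X_closed : closed X) (X_convex : convex_set X)
  (xi_support : {ae P, forall w, Xi (xi w)})
  (f_continuous : continuous f) (f_quasiconvex : quasiconvex f)
  (g_C1 : continuously_differentiable g)
  (Xnu_nonempty : sublevel X f nu !=set0)
  (Xnu_compact : compact (sublevel X f nu))
  (no_mass_at_zero : forall x, sublevel X f nu x ->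
    P [set w | vmax (fun j => g (x, xi w) ord0 j) = 0] = 0%E)
  (phi_C1 : forall k j,
    (forall y, derivable (phi k j) y 1) /\ continuous (derive1 (phi k j)))
  (phi_nondecreasing : forall k j, {homo phi k j : y z / y <= z})
  (phi_bounded : exists2 M : R, 0 < M & forall k j y, `|phi k j y| <= M)
  (phi_limit : forall j y, y != 0 -> phi k j y @[k --> \oo] --> step y) :
  (exists (v : nat -> R) (v0 : R),
    [/\ forall k, is_min (sublevel X f nu) (approx_prob xi g (phi k)) (v k)%:E,
        is_min (sublevel X f nu) (violation_prob xi g) v0%:E
      & v k @[k --> \oo] --> v0]) /\
  outer_limit (fun k => argmin (sublevel X f nu) (approx_prob xi g (phi k)))
    `<=` argmin (sublevel X f nu) (violation_prob xi g).
Proof.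
have g_cont : continuous g by move=> z; exact/differentiable_continuous/g_C1.1.
have phi_cont k j : continuous (phi k j).
  by move=> y; apply/differentiable_continuous/derivable1_diffP/(phi_C1 k j).1.
have [M _ phiM] := phi_bounded.
set A := sublevel X f nu.
have FG_cvg k u x : {homo k : i j / (i < j)%N} ->
    (forall i, A (u i)) -> A x -> u i @[i --> \oo] --> x ->
    approx_prob xi g (phi (k i)) (u i) @[i --> \oo] --> violation_prob xi g x.
  (* The subsequence [phi \o k] inherits all assumptions on [phi], the limit at nonzero points
     because [k] tends to infinity. *)
  move=> kinc _ Ax ux; apply: (cvg_approx_prob_violation g_cont (M := M)
    (phi := phi \o k)) => //=; [|exact: no_mass_at_zero].
  move=> j y y0.
  exact: cvg_comp (cvgny_strictly_increasing kinc) (phi_limit j y y0).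
have hrV : hausdorff_space 'rV[R]_n by exact: norm_hausdorff.
split; last exact: (outer_limit_argmin Xnu_compact hrV FG_cvg).
have /choice[u uP] : forall k, exists x, argmin A (approx_prob xi g (phi k)) x.
  move=> k; apply: (argmin_nonempty Xnu_compact) => // u x _ _.
  exact: (cvg_approx_prob g_cont (M := M)).
have [x0 x0min cvg_min] := cvg_argmin Xnu_compact hrV FG_cvg uP.
have fin_approx k y : approx_prob xi g (phi k) y \is a fin_num.
  exact: (approx_prob_fin_num xi g_cont (M := M)).
have fin_viol : violation_prob xi g x0 \is a fin_num.
  by apply: fin_num_measure; exact: measurable_violation.
(* All these values are finite, so [fine] turns the extended-real convergence into a real one
   without altering the minima. *)
exists (fun k => fine (approx_prob xi g (phi k) (u k))),
  (fine (violation_prob xi g x0)); split.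
- by move=> k; exists (u k) => //; rewrite fineK.
- by exists x0 => //; rewrite fineK.
- by apply: fine_cvg; rewrite fineK.
Qed.
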